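(* Let $T\in(0,\infty)$ and let $l:[0,T]\times[0,T]\to\mathbf{R}$ be a bounded measurable function with $l(t,s)=0$ whenever $s>t$. Put $y(t,u):=1-\int_u^t l(s,u)\,ds$ for $t,u\in[0,T]$, and let $C$ be a positive constant satisfying $$|y(t,u)-y(s,u)|\le C|t-s|\qquad(0\le t,s,u\le T).$$ Let $r,b\in\mathbf{R}$, $\sigma\in(0,\infty)$, $s_0\in(0,\infty)$, and for $N\in\mathbf{N}$ let $\mathcal{M}^{(N)}$ be the $\lfloor NT\rfloor$-period binary market determined by $y,r,b,\sigma,s_0$ as described in the context. Suppose that $T<1/C$. Then there exists an integer $N_0$ such that for each $N\ge N_0$ the market $\mathcal{M}^{(N)}$ is arbitrage-free.
   Context: Let $\{\xi_i\}_{i=1}^\infty$ be i.i.d. random variables with $P(\xi_1=1)=P(\xi_1=-1)=1/2$. For $N\in\mathbf{N}$ put $r^{(N)}:=r/N$, $b^{(N)}:=b/N$, and for $n=1,\dots,\lfloor NT\rfloor$ $$X^{(N)}_n:=\frac{\sigma}{\sqrt N}\left[\sum_{i=1}^{n-1}\left\{y(\tfrac nN,\tfrac iN)-y(\tfrac{n-1}N,\tfrac iN)\right\}\xi_i+\xi_n\right].$$ Equivalently $X^{(N)}_n=\sigma\,\Delta Y^{(N)}_{n/N}$, the jump at time $n/N$ (times $\sigma$) of $Y^{(N)}_t=\frac1{\sqrt N}\sum_{i=1}^{\lfloor Nt\rfloor}y(\tfrac{\lfloor Nt\rfloor}{N},\tfrac iN)\xi_i$. The market $\mathcal{M}^{(N)}$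 consists of a money market (bond) price process $B^{(N)}$ and a stock price process $S^{(N)}$ given by $$B^{(N)}_n=B^{(N)}_{n-1}(1+r^{(N)}),\quad B^{(N)}_0=1,\qquad S^{(N)}_n=S^{(N)}_{n-1}(1+b^{(N)}+X^{(N)}_n),\quad S^{(N)}_0=s_0,$$ for $n=1,\dots,\lfloor NT\rfloor$. The information available at time $n$ is generated by $\xi_1,\dots,\xi_n$. The market is arbitrage-free if there is no self-financing trading strategy in bond and stock (holdings during period $n$ depending only on $\xi_1,\dots,\xi_{n-1}$) with zero initial wealth whose terminal wealth at time $\lfloor NT\rfloor$ is almost surely nonnegative and is strictly positive with positive probability. $\lfloor x\rfloor$ denotes the greatest integer not exceeding $x$. *)

(* Defs.v *)
From HB Require Import structures.
From mathcomp Require Import all_boot all_order all_algebra.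
From mathcomp Require Import finmap.
From mathcomp Require Import all_classical all_reals all_analysis.

Set Implicit Arguments.
Unset Strict Implicit.
Unset Printing Implicit Defensive.

Import Order.TTheory GRing.Theory Num.Theory.
Import numFieldNormedType.Exports.

Local Open Scope classical_set_scope.
Local Open Scope ring_scope.

Definition mutually_independent d (Omega : measurableType d) (R : realType)
    (P : probability Omega R) (I : choiceType) (D : set I)
    (X : I -> {RV P >-> R}) : Prop :=
  forall (J : {fset I}) (A : I -> set R),
    [set` J] `<=` D -> (forall i, measurable (A i)) ->
    P (\bigcap_(i in [set` J]) (X i @^-1` A i)) =
    (\big[*%E/1]_(i <- J) P (X i @^-1` A i))%E.

Definition identically_distributed d (Omega : measurableType d) (R : realType)
    (P : probability Omega R) (I : choiceType) (D : set I)
    (X : I -> {RV P >-> R}) : Prop :=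
  forall i j (A : set R), D i -> D j -> measurable A ->
    distribution P (X i) A = distribution P (X j) A.

(* The sequence is xi_1, xi_2, ...: nothing is assumed of the term xi 0,
   and the market below does not use it. *)
Definition iid_signs d (Omega : measurableType d) (R : realType)
    (P : probability Omega R) (xi : nat -> {RV P >-> R}) : Prop :=
  [/\ mutually_independent [set i | (1 <= i)%N] xi,
      identically_distributed [set i | (1 <= i)%N] xi,
      P (xi 1%N @^-1` [set 1]) = (1 / 2)%:E
    & P (xi 1%N @^-1` [set -1]) = (1 / 2)%:E].

(* \int_a^b f, with the usual sign convention when b < a. *)
Definition oriented_integral (R : realType) (f : R -> R) (a b : R) : R :=
  if a <= b then \int[@lebesgue_measure R]_(x in `[a, b]) f x
  else - \int[@lebesgue_measure R]_(x in `[b, a]) f x.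

Definition ykernel (R : realType) (l : R -> R -> R) (t u : R) : R :=
  1 - oriented_integral (fun s => l s u) u t.

Section multiperiod_market.
Context d (Omega : measurableType d) (R : realType) (P : probability Omega R).
(* M is the number of periods, and F n is the sigma-algebra of events known at
   time n; prices are at times 0, ..., M, holdings over periods 1, ..., M. *)
Variables (M : nat) (F : nat -> set (set Omega)).
Variables (B : nat -> R) (S : nat -> Omega -> R).

Definition predictable (h : nat -> Omega -> R) : Prop :=
  forall (n : nat) (A : set R), (1 <= n <= M)%N -> measurable A ->
    F n.-1 (h n @^-1` A).

(* Time 0 is the opening of period 1, so maxn n 1 selects the holdings that
   are valued at time n: those of period n, or of period 1 when n = 0. *)
Definition wealth (alpha phi : nat -> Omega -> R) (n : nat) (w : Omega) : R :=
  alpha (maxn n 1) w * B n + phi (maxn n 1) w * S n w.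

Definition self_financing (alpha phi : nat -> Omega -> R) : Prop :=
  forall n : nat, (1 <= n < M)%N ->
    {ae P, forall w, wealth alpha phi n w =
                     alpha n.+1 w * B n + phi n.+1 w * S n w}.

Definition is_arbitrage (alpha phi : nat -> Omega -> R) : Prop :=
  [/\ predictable alpha /\ predictable phi,
      self_financing alpha phi,
      forall w, wealth alpha phi 0 w = 0,
      {ae P, forall w, (0 <= wealth alpha phi M w)%R}
    & (0 < P [set w | (0 < wealth alpha phi M w)%R])%E].

Definition arbitrage_free : Prop :=
  ~ exists alpha phi : nat -> Omega -> R, is_arbitrage alpha phi.

End multiperiod_market.

Section binary_market.
Context d (Omega : measurableType d) (R : realType) (P : probability Omega R).
Variables (xi : nat -> {RV P >-> R}) (T : R) (y : R -> R -> R).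
Variables (r b sigma s0 : R) (N : nat).

Definition nperiods : nat := Num.truncn (N%:R * T).

Definition Xincr (n : nat) (w : Omega) : R :=
  sigma / Num.sqrt N%:R *
  (\sum_(1 <= i < n)
      (y (n%:R / N%:R) (i%:R / N%:R) - y ((n%:R - 1) / N%:R) (i%:R / N%:R))
      * xi i w
   + xi n w).

Fixpoint bond (n : nat) : R :=
  if n is m.+1 then bond m * (1 + r / N%:R) else 1.

Fixpoint stock (n : nat) (w : Omega) : R :=
  if n is m.+1 then stock m w * (1 + b / N%:R + Xincr m.+1 w) else s0.

Definition signs_filtration (n : nat) : set (set Omega) :=
  g_sigma_preimage (fun i : 'I_n => (xi i.+1 : Omega -> R)).

Definition binary_market_arbitrage_free : Prop :=
  arbitrage_free P nperiods signs_filtration bond stock.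

End binary_market.

(* Main.v *)
(** By the Lipschitz bound, the part of [Xincr n] that depends on the past signs
    is at most [sigma / sqrt N * C * T] in absolute value, with [C * T < 1], so
    the sign of [Xincr n] is that of [xi n] and its size is at least
    [sigma / sqrt N * (1 - C * T)].  This beats [|r - b| / N] for large [N]: in
    each period the return of the stock exceeds that of the bond if [xi n = 1]
    and falls short of it if [xi n = -1].  Outside a null set one is on a binary
    tree all of whose branches occur; along it, nonnegativity of the terminal
    wealth propagates backwards, and then vanishing of the initial wealth
    propagates forwards. *)
Require Import Defs.
From HB Require Import structures.
From mathcomp Require Import all_boot all_order all_algebra.
From mathcomp Require Import finmap.
From mathcomp Require Import all_classical all_reals all_analysis.
From mathcomp Require Import measurable_realfun.
From mathcomp Require Import ring lra.

Set Implicit Arguments.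
Unset Strict Implicit.
Unset Printing Implicit Defensive.

Import Order.TTheory GRing.Theory Num.Theory.
Import numFieldNormedType.Exports.

Local Open Scope classical_set_scope.
Local Open Scope ring_scope.

(** * Sign histories, the filtration they generate, and a no-arbitrage criterion *)

Section signs.
Context {d : measure_display} {Omega : measurableType d} {R : realType}.
Context {P : probability Omega R} (xi : nat -> {RV P >-> R}).

Definition sign_pattern (e : nat -> R) : Prop :=
  forall i, (1 <= i)%N -> e i = 1 \/ e i = -1.

Definition same_signs (n : nat) (w w' : Omega) : Prop :=
  forall i, (1 <= i <= n)%N -> xi i w = xi i w'.

Lemma same_signs_sym n w w' : same_signs n w w' -> same_signs n w' w.
Proof. by move=> ww' i /ww'. Qed.

Lemma same_signsW m n w w' : (m <= n)%N -> same_signs n w w' -> same_signs m w w'.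
Proof.
by move=> mn ww' i /andP[i1 im]; apply: ww'; rewrite i1 (leq_trans im mn).
Qed.

(** The sets closed under [same_signs n] form a sigma-algebra, symmetry of the relation giving
    complements, and it contains the generating preimages. Hence it contains the sigma-algebra that
    they generate. *)
Lemma signs_filtration_saturated n (A : set Omega) w w' :
  signs_filtration xi n A -> same_signs n w w' -> A w -> A w'.
Proof.
move=> FA; move: w w'.
apply: (FA [set B | forall w w', same_signs n w w' -> B w -> B w']).
split; first split => //=.
- move=> B satB w w' ww' [_ nBw]; split=> // Bw'.
  exact/nBw/(satB w')/Bw'/same_signs_sym.
- by move=> G satG w w' ww' [k _ Gkw]; exists k => //; exact: satG Gkw.
- apply: (big_ind (fun G => G `<=` _)) => [//|G H sG sH B []|i _ B].
  + exact: sG.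
  + exact: sH.
  + by move=> [A0 _ <-] w w' ww' [_ Aw]; split=> //=; rewrite -(ww' i.+1) //=.
Qed.

Lemma signs_filtration_measurable n (A : set Omega) :
  signs_filtration xi n A -> measurable A.
Proof.
move=> FA; apply: (FA measurable); split; first exact: sigma_algebra_measurable.
apply: (big_ind (fun G => G `<=` _)) => [//|G H sG sH B []|i _ B].
- exact: sG.
- exact: sH.
- by move=> [A0 mA0 <-]; exact: measurable_funP.
Qed.

Lemma measurable_sign i (e : R) : measurable (xi i @^-1` [set e]).
Proof. by rewrite -[X in measurable X]setTI; exact: measurable_funP. Qed.

Hypothesis xiP : iid_signs xi.

Lemma probability_sign i e : (1 <= i)%N -> e = 1 \/ e = -1 ->
  P (xi i @^-1` [set e]) = (1 / 2)%:E.
Proof.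
case: xiP => _ idd Pp Pm i1 eE.
have -> : P (xi i @^-1` [set e]) = P (xi 1%N @^-1` [set e]).
  exact: (idd i 1%N [set e]).
by case: eE => ->.
Qed.

(** At each index from 1 on, the two values carry mass 1/2 + 1/2 = 1; the countably many exceptional
    null sets are discarded together. *)
Lemma ae_sign_pattern :
  {ae P, forall w, sign_pattern (fun i => xi i w)}.
Proof.
apply/ae_foralln => i.
have [->|i1] := posnP i; first exact: aeW.
have P0 : P (~` (xi i @^-1` [set 1] `|` xi i @^-1` [set -1])) = 0%E.
  rewrite probability_setC; last by apply: measurableU; exact: measurable_sign.
  have -> : P (xi i @^-1` [set 1] `|` xi i @^-1` [set -1]) =
      (P (xi i @^-1` [set 1%R]) + P (xi i @^-1` [set (-1)%R]))%E.
    apply: measureU; [exact: measurable_sign..|].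
    by apply/seteqP; split=> // w [/= ->] ?; lra.
  rewrite !probability_sign //; [|by right|by left].
  by rewrite -EFinD; congr EFin; field.
exists (~` (xi i @^-1` [set 1] `|` xi i @^-1` [set -1])); split => //.
- by apply/measurableC/measurableU; exact: measurable_sign.
- move=> w /= nxi H; apply: nxi => _; exact: H.
Qed.

(** By independence the cylinder of the first [n] signs of [e] has probability a product of factors
    1/2, hence positive, so it is not contained in the null set outside which [Q] holds. This lets
    almost sure facts be used on every branch of the tree. *)
Lemma ae_realises_sign_pattern (n : nat) (e : nat -> R) (Q : Omega -> Prop) :
  sign_pattern e -> {ae P, forall w, Q w} ->
  exists2 w, Q w & forall i, (1 <= i <= n)%N -> xi i w = e i.
Proof.
move=> eP [Z [mZ Z0 nQZ]].
pose J := [fset i in iota 1 n]%fset.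
have JP i : (i \in J) = (1 <= i <= n)%N.
  by rewrite /J inE /= mem_iota add1n ltnS.
pose E := \bigcap_(i in [set` J]) (xi i @^-1` [set e i]).
have PE : (0 < P E)%E.
  case: xiP => ind _ _ _.
  rewrite /E (ind J (fun i => [set e i])) //; last first.
    by move=> i /=; rewrite JP => /andP[].
  rewrite big_seq; apply: (big_ind (fun x : \bar R => 0 < x)%E) => //.
    by move=> x y; exact: mule_gt0.
  move=> i; rewrite JP => /andP[i1 _].
  by rewrite probability_sign ?lte_fin //; exact: eP.
have mE : measurable E.
  by apply: bigcap_measurableType => // i _; exact: measurable_sign.
have [EZ|] := pselect (E `<=` Z).
  have : (P E <= P Z)%E by apply: le_measure => //; rewrite inE.
  by rewrite Z0 leNgt PE.
move=> /existsNP[w /not_implyP[Ew nZw]]; exists w.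
  by apply: contrapT => nQ; apply: nZw; exact: nQZ.
by move=> i iP; apply: (Ew i); rewrite /= JP.
Qed.

(** The level set of [h n.+1] through [w] is an event known at time [n], so by saturation it also
    contains [w']. *)
Lemma predictable_same_signs M (h : nat -> Omega -> R) n w w' :
  predictable M (signs_filtration xi) h -> (n < M)%N -> same_signs n w w' ->
  h n.+1 w = h n.+1 w'.
Proof.
move=> ph nM ww'.
have Fh := ph n.+1 [set h n.+1 w] nM (measurable_set1 _).
by rewrite (signs_filtration_saturated Fh ww').
Qed.

Lemma predictable_measurable M (h : nat -> Omega -> R) n :
  predictable M (signs_filtration xi) h -> (1 <= n <= M)%N ->
  measurable_fun setT (h n).
Proof.
move=> ph nM _ A mA; rewrite setTI.
exact: signs_filtration_measurable (ph _ A nM mA).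
Qed.

(** Here [rho] is the return of the bond per period and [x] that of the stock. After every history
    the excess return takes both signs, so a nonzero amount in the stock, long or short, loses
    against the bond on one of the two branches. *)
Lemma two_sided_returns_arbitrage_free (M : nat) (B : nat -> R)
    (S x : nat -> Omega -> R) (rho : R) :
  0 < 1 + rho ->
  (forall n, B n.+1 = B n * (1 + rho)) ->
  (forall n w, S n.+1 w = S n w * (1 + x n.+1 w)) ->
  (forall n, measurable_fun setT (S n)) ->
  (forall n w w', same_signs n w w' -> S n w = S n w') ->
  (forall n w, (1 <= n <= M)%N -> sign_pattern (fun i => xi i w) ->
     (xi n w = 1 -> rho < x n w) /\ (xi n w = -1 -> x n w < rho)) ->
  arbitrage_free P M (signs_filtration xi) B S.
Proof.
move=> rho0 BS SS mS Ssat xP [alpha [phi [[pa pp] sf V0 VM]]].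
(* Without periods the terminal wealth is the initial wealth 0. Otherwise the number of periods is
   [M.+1] from here on. *)
case: M => [|M] in xP pa pp sf VM *.
  rewrite [X in P X](_ : _ = set0) ?measure0 ?ltxx //.
  by apply/seteqP; split=> // w /=; rewrite V0 ltxx.
apply/negP; rewrite -leNgt.
(* [V n] is the wealth at time [n] before rebalancing and [U n] the wealth after it. They agree on
   [Q]: at [n = 0] by the convention in [wealth], at later times by self-financing. *)
pose V := wealth B S alpha phi.
pose U n w := alpha n.+1 w * B n + phi n.+1 w * S n w.
(* [Q] gathers the pathwise forms of all the almost sure facts, so that the two inductions below can
   run scenario by scenario. *)
pose Q w := [/\ sign_pattern (fun i => xi i w),
  (forall n, (1 <= n < M.+1)%N -> V n w = U n w) & 0 <= V M.+1 w].
have aeQ : {ae P, forall w, Q w}.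
  have sf' : {ae P, forall w n, (1 <= n < M.+1)%N -> V n w = U n w}.
    apply/ae_foralln => n; case: (boolP (1 <= n < M.+1)%N) => nM.
      by apply: filterS (sf n nM) => w h _.
    exact: aeW.
  by apply: filterS3 ae_sign_pattern sf' VM => w.
have VU n w : Q w -> (n <= M)%N -> V n w = U n w.
  by case=> _ QU _ nM; case: n nM => // n nM; exact: QU.
have maxnS1 n : maxn n.+1 1 = n.+1 by exact/maxn_idPl.
have VS n w : V n.+1 w =
    (1 + rho) * U n w + phi n.+1 w * S n w * (x n.+1 w - rho).
  by rewrite /V /wealth /U maxnS1 SS BS; ring.
have Usat n w w' : (n <= M)%N -> same_signs n w w' -> U n w = U n w'.
  move=> nM ww'; rewrite /U (predictable_same_signs pa _ ww') //.
  by rewrite (predictable_same_signs pp _ ww') // (Ssat _ _ _ ww').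
have branch n w e : Q w -> (n <= M)%N -> e = 1 \/ e = -1 ->
    exists w', [/\ Q w', same_signs n w w' & xi n.+1 w' = e].
  move=> [wP _ _] nM eP.
  (* The history of [w] up to time [n], continued by [e]; the signs after [n.+1] are mere filler,
     since only the first [n.+1] are realised. *)
  have fP : sign_pattern (fun i => if i == n.+1 then e else xi i w).
    by move=> i i1; case: eqP => // _; exact: wP.
  have [w' Qw' w'E] := ae_realises_sign_pattern n.+1 fP aeQ.
  exists w'; split=> //; last by rewrite w'E ?eqxx //=.
  move=> i /andP[i1 iN]; rewrite w'E ?i1 ?(leqW iN) //.
  by rewrite ltn_eqF.
(* Each period branches from [w] to an up and a down scenario, where the gain
   [phi * S * (x - rho)] has opposite signs. *)
have step n w : Q w -> (n <= M)%N -> (forall w', Q w' -> 0 <= V n.+1 w') ->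
    exists xu xd, [/\ xd < rho, rho < xu,
      0 <= (1 + rho) * U n w + phi n.+1 w * S n w * (xu - rho) &
      0 <= (1 + rho) * U n w + phi n.+1 w * S n w * (xd - rho)].
  move=> Qw nM V_ge0.
  have [u [Qu wu xu]] := branch n w 1 Qw nM (or_introl erefl).
  have [v [Qv wv xv]] := branch n w (-1) Qw nM (or_intror erefl).
  exists (x n.+1 u), (x n.+1 v).
  have gain z : same_signs n w z -> Q z ->
      0 <= (1 + rho) * U n w + phi n.+1 w * S n w * (x n.+1 z - rho).
    move=> wz Qz; have := V_ge0 _ Qz; rewrite VS -(Usat n w z) //.
    by rewrite -(predictable_same_signs pp _ wz) // -(Ssat _ _ _ wz).
  have [uP _ _] := Qu; have [vP _ _] := Qv.
  by split; [exact: (xP _ _ _ vP).2|exact: (xP _ _ _ uP).1|exact: gain|exact: gain].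
(* Backward induction, [k] being the number of periods left. *)
have V_ge0 k : (k <= M.+1)%N -> forall w, Q w -> 0 <= V (M.+1 - k)%N w.
  elim: k => [_ w [_ _]|k IH kM w Qw]; first by rewrite subn0.
  rewrite subSS; have nM : (M - k <= M)%N by exact: leq_subr.
  have := IH (ltnW kM); rewrite subSn // => /(step _ w Qw nM).
  rewrite VU // => -[xu [xd [dlt ult]]].
  set g := phi _ w * S _ w; set u := U _ w => hu hd.
  (* A long position cannot gain on the down branch, nor a short one on the up branch. As wealth is
     nonnegative even there, [(1 + rho) * u] is too. *)
  have [g0|g0] := leP 0 g.
    rewrite -(pmulr_rge0 _ rho0); apply: le_trans hd _.
    by rewrite gerDl mulr_ge0_le0 // subr_le0 ltW.
  rewrite -(pmulr_rge0 _ rho0); apply: le_trans hu _.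
  by rewrite gerDl mulr_le0_ge0 ?subr_ge0 // ltW.
have V_eq0 n : (n <= M.+1)%N -> forall w, Q w -> V n w = 0.
  elim: n => [_ w _|n IH nM w Qw]; first exact: V0.
  have U0 : U n w = 0 by rewrite -VU //; exact: IH (ltnW nM) w Qw.
  have Vn w' : Q w' -> 0 <= V n.+1 w'.
    by move/(V_ge0 (M.+1 - n.+1)%N (leq_subr _ _)); rewrite subKn.
  have [xu [xd [dlt ult]]] := step n w Qw nM Vn.
  (* With [U n w = 0] only the gain remains: the up branch forces the amount in the stock to be
     nonnegative, the down branch nonpositive. *)
  rewrite VS U0 mulr0 !add0r pmulr_lge0 ?subr_gt0 // => g0.
  rewrite nmulr_lge0 ?subr_lt0 // => g0'.
  have -> : phi n.+1 w * S n w = 0 by apply/eqP; rewrite eq_le g0 g0'.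
  by rewrite mul0r.
have mV : measurable_fun setT (V M.+1).
  rewrite /V /wealth; apply: measurable_funD; apply: measurable_funM => //.
  - by apply: (predictable_measurable pa); rewrite maxnS1 ltnSn.
  - by apply: (predictable_measurable pp); rewrite maxnS1 ltnSn.
have mV0 : measurable [set w | 0 < V M.+1 w].
  rewrite [X in measurable X](_ : _ = setT `&` V M.+1 @^-1` `]0, +oo[).
    exact: mV.
  by rewrite setTI; apply/seteqP; split=> w /=; rewrite in_itv /= andbT.
have [Z [mZ Z0 nQZ]] := aeQ.
rewrite -Z0; apply: le_measure; rewrite ?inE // => w /= Vw.
by apply: nQZ => /(V_eq0 M.+1 (leqnn _) w) Vw0; move: (Vw : 0 < V M.+1 w); rewrite Vw0 ltxx.
Qed.

End signs.

(** * Adaptedness, measurability and the size of the jumps in the binary market *)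

Section binary_market_jumps.
Context {d : measure_display} {Omega : measurableType d} {R : realType}.
Context {P : probability Omega R} (xi : nat -> {RV P >-> R}).
Variables (T : R) (y : R -> R -> R) (C b sigma s0 : R) (N : nat).

Lemma Xincr_same_signs n w w' : same_signs xi n.+1 w w' ->
  Xincr xi y sigma N n.+1 w = Xincr xi y sigma N n.+1 w'.
Proof.
move=> ww'; rewrite /Xincr ww' ?ltnSn //; congr (_ * (_ + _)).
rewrite [LHS]big_nat [RHS]big_nat; apply: eq_bigr => i /andP[i1 iN].
by rewrite ww' // i1 ltnW.
Qed.

Lemma stock_same_signs n w w' : same_signs xi n w w' ->
  stock xi y b sigma s0 N n w = stock xi y b sigma s0 N n w'.
Proof.
elim: n => //= n IH ww'; rewrite (IH (same_signsW (leqnSn n) ww')).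
by rewrite (Xincr_same_signs ww').
Qed.

Lemma measurable_Xincr n : measurable_fun setT (Xincr xi y sigma N n).
Proof.
apply: measurable_funM => //; apply: measurable_funD; last exact: measurable_funP.
by apply: measurable_sum => i; apply: measurable_funM.
Qed.

Lemma measurable_stock n : measurable_fun setT (stock xi y b sigma s0 N n).
Proof.
elim: n => [|n IH]; first exact: measurable_cst.
apply: measurable_funM => //; apply: measurable_funD => //.
exact: measurable_Xincr.
Qed.

(** As [n <= N * T], all grid points involved lie in [[0, T]], where the Lipschitz bound applies.
    Consecutive ones are [1 / N] apart, so each of the [n - 1] terms is at most [C / N], and
    [n - 1 <= N * T]. *)
Lemma past_jump_bound n w :
  0 < C -> 0 < T -> (0 < N)%N ->
  (forall t s u : R, 0 <= t <= T -> 0 <= s <= T -> 0 <= u <= T ->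
     `|y t u - y s u| <= C * `|t - s|) ->
  (1 <= n <= nperiods T N)%N -> sign_pattern (fun i => xi i w) ->
  `|\sum_(1 <= i < n)
      (y (n%:R / N%:R) (i%:R / N%:R) - y ((n%:R - 1) / N%:R) (i%:R / N%:R))
      * xi i w| <= C * T.
Proof.
move=> C0 T0 N0 yC /andP[n1 nM] wP.
have N0' : 0 < N%:R :> R by rewrite ltr0n.
have nT : n%:R <= N%:R * T.
  by rewrite -truncn_ge_nat // mulr_ge0 // ltW.
have inT i : (i <= n)%N -> 0 <= (i%:R / N%:R : R) <= T.
  move=> iN; rewrite divr_ge0 ?ler0n //= ler_pdivrMr // mulrC.
  by apply: le_trans nT; rewrite ler_nat.
apply: (@le_trans _ _ (\sum_(1 <= i < n) C / N%:R)).
  apply: (le_trans (ler_norm_sum _ _ _)).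
  rewrite [leLHS]big_nat [leRHS]big_nat; apply: ler_sum => i /andP[i1 iN].
  have -> : forall a, `|a * xi i w| = `|a|.
    move=> a; rewrite normrM.
    by case: (wP i i1) => ->; rewrite ?normrN normr1 mulr1.
  have -> : n%:R - 1 = n.-1%:R :> R by rewrite -subn1 natrB.
  apply: (le_trans (yC _ _ _ (inT _ (leqnn n)) (inT _ (leq_pred n))
    (inT _ (ltnW iN)))).
  rewrite -mulrBl -[in n%:R](prednK n1) -addn1 natrD addrC addrA addNr add0r.
  by rewrite mul1r ger0_norm // invr_ge0 ltW.
rewrite sumr_const_nat -[_ *+ (n - 1)]mulr_natr -mulrA ler_wpM2l ?(ltW C0) //.
rewrite mulrC ler_pdivrMr // mulrC; apply: le_trans nT.
by rewrite ler_nat leq_subr.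
Qed.

End binary_market_jumps.

Theorem theorem4p1 (R : realType) (d : measure_display)
  (Omega : measurableType d) (P : probability Omega R)
  (xi : nat -> {RV P >-> R}) (T : R) (l : R -> R -> R)
  (C r b sigma s0 : R) :
  iid_signs xi ->
  0 < T ->
  (exists K : R, forall t s : R, 0 <= t <= T -> 0 <= s <= T ->
     `|l t s| <= K) ->
  measurable_fun (`[0, T] `*` `[0, T]) (fun p : R * R => l p.1 p.2) ->
  (forall t s : R, 0 <= t <= T -> 0 <= s <= T -> t < s -> l t s = 0) ->
  0 < C ->
  (forall t s u : R, 0 <= t <= T -> 0 <= s <= T -> 0 <= u <= T ->
     `|ykernel l t u - ykernel l s u| <= C * `|t - s|) ->
  0 < sigma ->
  0 < s0 ->
  T < 1 / C ->
  exists N0 : nat, forall N : nat, (0 < N)%N -> (N0 <= N)%N ->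
    binary_market_arbitrage_free xi T (ykernel l) r b sigma s0 N.
Proof.
move=> xiP T0 _ _ _ C0 yC sigma0 s00 TC.
have CT : 0 < 1 - C * T by rewrite subr_gt0 mulrC -ltr_pdivlMr.
(* [a] is the threshold that [Num.sqrt N%:R] must exceed for [small] to hold, whence [a ^+ 2 < N].
   The other requirement, [|r| < N], keeps the growth factor [1 + r / N] of the bond positive. *)
pose a := `|r - b| / (sigma * (1 - C * T)).
exists (Num.truncn (Num.max `|r| (a ^+ 2))).+1 => N N0 NN.
have NR : 0 < N%:R :> R by rewrite ltr0n.
have : Num.max `|r| (a ^+ 2) < N%:R.
  by apply: lt_le_trans (truncnS_gt _) _; rewrite ler_nat.
rewrite gt_max => /andP[rN aN].
have sN0 : 0 < Num.sqrt N%:R :> R by rewrite sqrtr_gt0.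
have sNN : Num.sqrt N%:R * Num.sqrt N%:R = N%:R :> R.
  by rewrite -expr2 sqr_sqrtr // ltW.
have small : `|r - b| / N%:R < sigma / Num.sqrt N%:R * (1 - C * T).
  have : a < Num.sqrt N%:R.
    have a0 : 0 <= a by rewrite divr_ge0 // mulr_ge0 // ltW.
    by rewrite -(ger0_norm a0) -sqrtr_sqr ltr_sqrt.
  rewrite /a ltr_pdivrMr ?mulr_gt0 // => h.
  rewrite ltr_pdivrMr // -{2}sNN.
  by rewrite [ltRHS](_ : _ = Num.sqrt N%:R * (sigma * (1 - C * T))) //; field; rewrite gt_eqF.
apply: (two_sided_returns_arbitrage_free xiP
  (x := fun n w => b / N%:R + Xincr xi (ykernel l) sigma N n w) (rho := r / N%:R)).
- have : - 1 < r / N%:R; last lra.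
  rewrite ltr_pdivlMr // mulN1r; apply: lt_le_trans (_ : - `|r| <= _).
    by rewrite ltrN2.
  by rewrite lerNl -normrN ler_norm.
- by [].
- by move=> n w /=; rewrite addrA.
- exact: measurable_stock.
- exact: stock_same_signs.
- move=> n w nM wP.
  have := past_jump_bound C0 T0 N0 yC nM wP.
  rewrite /Xincr; set s := \sum_(_ <= _ < _) _; rewrite ler_norml => /andP[s1 s2].
  have k0 : 0 < sigma / Num.sqrt N%:R by rewrite divr_gt0.
  move: small; rewrite -[X in _ / X](gtr0_norm NR) -normf_div.
  rewrite mulrBl ltr_norml => /andP[rb1 rb2].
  split=> ->.
    have : sigma / Num.sqrt N%:R * (1 - C * T) <= sigma / Num.sqrt N%:R * (s + 1).
      by rewrite ler_pM2l //; lra.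
    lra.
  have : sigma / Num.sqrt N%:R * (s - 1) <= - (sigma / Num.sqrt N%:R * (1 - C * T)).
    by rewrite -mulrN ler_pM2l //; lra.
  lra.
Qed.
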